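(* Let $I$ be an infinite set and let $\{A_i\}_{i\in I}$ be a family of non-zero unital $^*$-algebras over $\mathbb C$. Suppose that there is a non-empty finite subset $F_0\subseteq I$ such that $A_i=\mathrm{span}\,U_{A_i}$ for every $i\in I\setminus F_0$. (a) $Z(\Omega^{\rm ut}_{I;A})=\Omega^{\rm ut}_{I;Z(A)}$. Moreover, $Z(\Omega^{\rm ut}_{I;A})=\Omega^{\rm ut}_{I;A}$ if and only if all but a finite number of the $A_i$ are commutative. (b) Every element of $\Omega^{\rm ut}_{I;A}\setminus Z(\Omega^{\rm ut}_{I;A})$ has an infinite conjugacy class in $\Omega^{\rm ut}_{I;A}$. (c) $Z\big(\bigotimes^{\rm ut}_{i\in I}A_i\big)=\bigotimes^{\rm ut}_{i\in I}Z(A_i)$.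
   Context: $Z(\cdot)$ denotes the centre of an algebra or of a group. For a unital $^*$-algebra $A$ with identity $e_A$, $U_A=\{a\in A:a^*a=aa^*=e_A\}$. The tensor product $\bigotimes_{i\in I}X_i$ of non-zero vector spaces is the vector space with a multilinear (linear in each variable separately) map $x\mapsto\otimes_{i\in I}x_i$ from $\prod_{i\in I}X_i$ through which every multilinear map from $\prod_{i\in I}X_i$ to a vector space factors via a unique linear map (it exists and is unique up to isomorphism). $\bigotimes_{i\in I}A_i$ is a $^*$-algebra with $(\otimes a_i)(\otimes b_i)=\otimes a_ib_i$, $(\otimes a_i)^*=\otimes a_i^*$. For $x,y\in\prod_{i\in I}(A_i\setminus\{0\})$, $x\sim y$ means $x_i=y_i$ for all but finitely many $i$. $\Omega^{\rm ut}_{I;A}=\prod_{i\in I}U_{A_i}/\sim$ is a group under coordinatewise multiplication. For $\omega=[u]_\sim\in\Omega^{\rm ut}_{I;A}$, $\bigotimes^\omega_{i\in I}A_i=\mathrm{span}\{\otimes_{i\in I}x_i:x\in\prod_{i\in I}A_i,\ x_i=u_i\text{ for all but finitely many }i\}$, and $\bigotimes^{\rm ut}_{i\in I}A_i=\bigoplus_{\omega\in\Omega^{\rm ut}_{I;A}}\bigotimes^\omega_{i\in I}A_i$, a unital $^*$-subalgebra of $\bigotimes_{i\in I}A_i$. $\Omega^{\rm ut}_{I;Z(A)}=\prod_{i\in I}U_{Z(A_i)}/\sim$ is regarded as a subgroup of $\Omega^{\rm ut}_{I;A}$ through the inclusion $\prod_{i\in I}U_{Z(A_i)}\subseteq\prod_{i\in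 I}U_{A_i}$, and $\bigotimes^{\rm ut}_{i\in I}Z(A_i)=\bigoplus_{\omega\in\Omega^{\rm ut}_{I;Z(A)}}\bigotimes^\omega_{i\in I}Z(A_i)$ is regarded as a subalgebra of $\bigotimes^{\rm ut}_{i\in I}A_i$ through the (injective) map induced by the inclusions $Z(A_i)\subseteq A_i$. *)

(* Defs.v *)
From HB Require Import structures.
From mathcomp Require Import all_boot all_order all_algebra.
From mathcomp Require Import all_classical all_reals.
From mathcomp Require Import complex.

Set Implicit Arguments.
Unset Strict Implicit.
Unset Printing Implicit Defensive.

Import Order.TTheory GRing.Theory Num.Theory.
Local Open Scope classical_set_scope.
Local Open Scope quotient_scope.
Local Open Scope ring_scope.

Definition lspan (K : fieldType) (V : lmodType K) (S : set V) : set V :=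
  [set v | exists n (c : 'I_n -> K) (x : 'I_n -> V),
     (forall k, S (x k)) /\ v = \sum_(k < n) c k *: x k].

Section Span.
Variables (K : fieldType) (V : lmodType K).
Implicit Types S : set V.

Lemma sub_lspan S : S `<=` lspan S.
Proof.
move=> x Sx; exists 1%N, (fun=> 1), (fun=> x); split=> //.
by rewrite big_ord1 scale1r.
Qed.

Lemma lspan0 S : lspan S 0.
Proof.
by exists 0%N, (fun=> 0), (fun=> 0); split=> [[]//|]; rewrite big_ord0.
Qed.

Lemma lspanD S x y : lspan S x -> lspan S y -> lspan S (x + y).
Proof.
move=> [n [c [u [Su ->]]]] [m [d [v [Sv ->]]]].
pose sel T (f : 'I_n -> T) (g : 'I_m -> T) (k : 'I_(n + m)) :=
  match fintype.split k with inl i => f i | inr j => g j end.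
have sell T f g i : sel T f g (lshift m i) = f i.
  by rewrite /sel (unsplitK (inl i)).
have selr T f g i : sel T f g (rshift n i) = g i.
  by rewrite /sel (unsplitK (inr i)).
exists (n + m)%N, (sel K c d), (sel V u v); split.
  by move=> k; rewrite /sel; case: fintype.splitP => j _.
by rewrite big_split_ord; congr (_ + _); apply: eq_bigr => i _;
  rewrite ?sell ?selr.
Qed.

Lemma lspanZ S a x : lspan S x -> lspan S (a *: x).
Proof.
move=> [n [c [u [Su ->]]]]; exists n, (fun k => a * c k), u; split=> //.
by rewrite scaler_sumr; apply: eq_bigr => k _; rewrite scalerA.
Qed.

(* [lspan S] is the least linear subspace containing [S]. *)
Lemma lspan_min S (P : set V) : P 0 -> (forall x y, P x -> P y -> P (x + y)) ->
  (forall a x, P x -> P (a *: x)) -> S `<=` P -> lspan S `<=` P.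
Proof.
move=> P0 PD PZ SP _ [n [c [u [Su ->]]]].
by apply: big_ind => // k _; apply/PZ/SP.
Qed.

End Span.

HB.mixin Record Algebra_hasStar (C : numClosedFieldType) A
    of GRing.Algebra C A := {
  star : A -> A;
  starK : involutive star;
  starD : {morph star : x y / x + y};
  starZ : forall (c : C) (x : A), star (c *: x) = c^* *: star x;
  starM : forall x y : A, star (x * y) = star y * star x
}.

(* [algType] rings satisfy [1 != 0], so that these algebras are non-zero. *)
#[short(type="starAlgType")]
HB.structure Definition StarAlgebra (C : numClosedFieldType) :=
  {A of GRing.Algebra C A & Algebra_hasStar C A}.

(* The centre of a subalgebra [B] of [A], as a subset of [A]. *)
Definition ring_center (A : pzRingType) (B : set A) : set A :=
  [set z | B z /\ forall y, B y -> z * y = y * z].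

Definition group_center (G : groupType) : set G :=
  [set z | forall y, (z * y = y * z)%g].
Arguments group_center G : clear implicits.

(* Linearity in the variable [j], the other variables being held fixed. *)
Definition multilinear (K : fieldType) (I : Type) (V : I -> lmodType K)
    (W : lmodType K) (f : (forall i, V i) -> W) :=
  forall (j : I) (c : K) (x y z : forall i, V i),
    (forall i, i <> j -> x i = z i /\ y i = z i) -> z j = c *: x j + y j ->
    f z = c *: f x + f y.

Section Tensor.
Variables (K : fieldType) (I : Type) (V : I -> lmodType K).

Definition formal_sum := {classic seq (K * (forall i, V i))}.

Definition lsum (W : lmodType K) (f : (forall i, V i) -> W) (s : formal_sum) : W :=
  \sum_(p <- (s : seq _)) p.1 *: f p.2.

(* Two formal combinations have the same class in the tensor product iff      *)
(* every multilinear map identifies them.                                     *)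
Definition tensor_rel (s t : formal_sum) : bool :=
  `[< forall (W : lmodType K) (f : (forall i, V i) -> W),
        multilinear f -> lsum f s = lsum f t >].

Lemma tensor_rel_refl : reflexive tensor_rel.
Proof. by move=> s; apply/asboolP. Qed.
Lemma tensor_rel_sym : symmetric tensor_rel.
Proof.
by move=> s t; apply/asboolP/asboolP => H W f mf; rewrite (H W f mf).
Qed.
Lemma tensor_rel_trans : transitive tensor_rel.
Proof.
move=> t s u /asboolP H1 /asboolP H2; apply/asboolP => W f mf.
by rewrite (H1 W f mf) (H2 W f mf).
Qed.

Canonical tensor_equiv :=
  EquivRel tensor_rel tensor_rel_refl tensor_rel_sym tensor_rel_trans.

Definition tensor := {eq_quot tensor_rel}.
HB.instance Definition _ := Choice.on tensor.

Definition tens_lift (W : lmodType K) (f : (forall i, V i) -> W)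
  (t : tensor) : W := lsum f (repr t).

Lemma tens_lift_pi (W : lmodType K) (f : (forall i, V i) -> W) s :
  multilinear f -> tens_lift f (\pi_tensor s) = lsum f s.
Proof.
move=> mf; rewrite /tens_lift.
have /eqmodP/asboolP H : repr (\pi_tensor s) = s %[mod tensor] by rewrite reprK.
exact: H.
Qed.

Lemma tens_ext (s t : tensor) :
  (forall (W : lmodType K) (f : (forall i, V i) -> W),
     multilinear f -> tens_lift f s = tens_lift f t) -> s = t.
Proof.
move=> H; rewrite -[s]reprK -[t]reprK; apply/eqmodP/asboolP => W f mf.
exact: H.
Qed.

Definition t0 : tensor := \pi_tensor ([::] : formal_sum).
Definition tadd (s t : tensor) : tensor :=
  \pi_tensor ((repr s : seq _) ++ (repr t : seq _) : formal_sum).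
Definition tscale (a : K) (s : tensor) : tensor :=
  \pi_tensor ([seq (a * p.1, p.2) | p <- (repr s : seq _)] : formal_sum).
Definition topp (s : tensor) : tensor := tscale (-1) s.
Definition tens (x : forall i, V i) : tensor :=
  \pi_tensor ([:: (1, x)] : formal_sum).

Section Lift.
Variables (W : lmodType K) (f : (forall i, V i) -> W).
Hypothesis mf : multilinear f.

Lemma lift_t0 : tens_lift f t0 = 0.
Proof. by rewrite tens_lift_pi// /lsum big_nil. Qed.
Lemma lift_tadd s t : tens_lift f (tadd s t) = tens_lift f s + tens_lift f t.
Proof. by rewrite tens_lift_pi// /lsum big_cat. Qed.
Lemma lift_tscale a s : tens_lift f (tscale a s) = a *: tens_lift f s.
Proof.
rewrite tens_lift_pi// /tens_lift /lsum big_map scaler_sumr.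
by apply: eq_bigr => p _; rewrite scalerA.
Qed.
Lemma lift_topp s : tens_lift f (topp s) = - tens_lift f s.
Proof. by rewrite lift_tscale scaleN1r. Qed.
Lemma tens_lift_tens x : tens_lift f (tens x) = f x.
Proof. by rewrite tens_lift_pi// /lsum big_seq1 scale1r. Qed.
End Lift.

Definition tliftE :=
  (lift_t0, lift_tadd, lift_tscale, lift_topp).

Lemma taddA : associative tadd.
Proof. by move=> x y z; apply: tens_ext => W f mf; rewrite !tliftE// addrA. Qed.
Lemma taddC : commutative tadd.
Proof. by move=> x y; apply: tens_ext => W f mf; rewrite !tliftE// addrC. Qed.
Lemma tadd0 : left_id t0 tadd.
Proof. by move=> x; apply: tens_ext => W f mf; rewrite !tliftE// add0r. Qed.
Lemma taddN : left_inverse t0 topp tadd.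
Proof. by move=> x; apply: tens_ext => W f mf; rewrite !tliftE// addNr. Qed.
HB.instance Definition _ := GRing.isZmodule.Build tensor taddA taddC tadd0 taddN.

Lemma tscaleA a b v : tscale a (tscale b v) = tscale (a * b) v.
Proof. by apply: tens_ext => W f mf; rewrite !tliftE// scalerA. Qed.
Lemma tscale1 : left_id 1 tscale.
Proof. by move=> v; apply: tens_ext => W f mf; rewrite !tliftE// scale1r. Qed.
Lemma tscaleDr : right_distributive tscale +%R.
Proof.
by move=> a u v; apply: tens_ext => W f mf; rewrite !tliftE// scalerDr.
Qed.
Lemma tscaleDl v : {morph tscale^~ v : a b / a + b}.
Proof.
by move=> a b; apply: tens_ext => W f mf; rewrite !tliftE// scalerDl.
Qed.
HB.instance Definition _ := GRing.Zmodule_isLmodule.Build K tensor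
  tscaleA tscale1 tscaleDr tscaleDl.

Lemma tens_lift_linear (W : lmodType K) (f : (forall i, V i) -> W) :
  multilinear f -> linear (tens_lift f).
Proof. by move=> mf a s t; rewrite lift_tadd// lift_tscale. Qed.

Lemma tens_multilinear : multilinear tens.
Proof.
move=> j c x y z xyz zj; apply: tens_ext => W f mf.
by rewrite (tens_lift_linear mf) !tens_lift_tens//; apply: mf xyz zj.
Qed.

Lemma tens_sum (t : tensor) : t = \sum_(p <- (repr t : seq _)) p.1 *: tens p.2.
Proof.
rewrite -[LHS]reprK; case: (repr t : seq _) => [|p s] /=.
  by rewrite big_nil.
elim: s p => [|q s IH] p.
  rewrite big_seq1; apply: tens_ext => W f mf.
  rewrite tens_lift_pi// lift_tscale// tens_lift_tens//.
  by rewrite /lsum big_seq1.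
rewrite big_cons -IH; apply: tens_ext => W f mf.
rewrite lift_tadd// lift_tscale// tens_lift_tens// !tens_lift_pi//.
by rewrite /lsum big_cons.
Qed.

Lemma tens_ind (P : tensor -> Prop) : P 0 ->
  (forall s t, P s -> P t -> P (s + t)) -> (forall c s, P s -> P (c *: s)) ->
  (forall x, P (tens x)) -> forall t, P t.
Proof.
move=> P0 PD PZ Pt t; rewrite [t]tens_sum.
by apply: big_ind => // p _; apply: PZ.
Qed.

Lemma tens_linear_eq (W : lmodType K) (g h : tensor -> W) :
  linear g -> linear h -> (forall x, g (tens x) = h (tens x)) -> g =1 h.
Proof.
move=> lg lh gh.
have z0 (k : tensor -> W) : linear k -> k 0 = 0 :> W.
  by move=> lk; have := lk (-1) 0 0; rewrite scaler0 addr0 scaleN1r addNr.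
have zD (k : tensor -> W) s t : linear k -> k (s + t) = k s + k t :> W.
  by move=> lk; have := lk 1 s t; rewrite !scale1r.
have zZ (k : tensor -> W) c s : linear k -> k (c *: s) = c *: k s :> W.
  by move=> lk; have := lk c s 0; rewrite (z0 k lk) !addr0.
elim/tens_ind => [|s t E1 E2|c s E|//]; first by rewrite !z0.
  by rewrite !zD// E1 E2.
by rewrite !zZ// E.
Qed.

(* The universal property of the tensor product. *)
Theorem tensor_universal (W : lmodType K) (f : (forall i, V i) -> W) :
  multilinear f ->
  exists! g : tensor -> W, linear g /\ forall x, g (tens x) = f x.
Proof.
move=> mf; exists (tens_lift f); split.
  by split; [exact: tens_lift_linear | exact: tens_lift_tens].
move=> g [lg gE]; apply/funext; apply: tens_linear_eq => //.
  exact: tens_lift_linear.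
by move=> x; rewrite gE tens_lift_tens.
Qed.

End Tensor.

Lemma linear_retraction (K : fieldType) (W V : lmodType K) (j : W -> V) :
  linear j -> injective j ->
  exists r : V -> W, linear r /\ cancel j r.
Proof.
move=> lj injj.
have j0 : j 0 = 0 by have := lj (-1) 0 0; rewrite scaler0 addr0 scaleN1r addNr.
have jZ c x : j (c *: x) = c *: j x by have := lj c x 0; rewrite j0 !addr0.
have jB x y : j (x - y) = j x - j y.
  by rewrite -scaleN1r addrC lj scaleN1r addrC.
pose P (A : set V) := [/\ (forall x y, A x -> A y -> A (x + y)),
  (forall a x, A x -> A (a *: x)) & forall w, A (j w) -> w = 0].
have [F FP Ftot|A [[AD AZ Aj] Amax]] := @Zorn_bigcup V P.
  split.
  - move=> x y [X FX Xx] [Y FY Yy].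
    have [XY|YX] := Ftot _ _ FX FY.
      by exists Y => //; have [YD _ _] := FP _ FY; apply: YD => //; apply: XY.
    by exists X => //; have [XD _ _] := FP _ FX; apply: XD => //; apply: YX.
  - by move=> a x [X FX Xx]; exists X => //; have [_ XZ _] := FP _ FX; apply: XZ.
  - by move=> w [X FX Xw]; have [_ _] := FP _ FX; apply.
have A0 : A 0.
  apply: contrapT => nA0.
  have nA x : ~ A x by move=> /(AZ 0); rewrite scale0r.
  apply: (Amax [set 0]).
    by split=> [x /nA//|/(_ 0 erefl)/nA].
  split.
  - by move=> x y /= -> ->; rewrite addr0.
  - by move=> a x /= ->; rewrite scaler0.
  - by move=> w /= jw; apply: injj; rewrite jw j0.
have ex x : exists w, A (x - j w).
  have [Ax|nAx] := pselect (A x); first by exists 0; rewrite j0 subr0.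
  pose B := [set y | exists d, A (y - d *: x)].
  have AB : A `<` B.
    split=> [y Ay|BA]; first by exists 0; rewrite scale0r subr0.
    by apply: nAx; apply: BA; exists 1; rewrite scale1r subrr.
  have [w [d [w0 Ad]]] : exists w d, w <> 0 /\ A (j w - d *: x).
    apply: contrapT => nB; apply: (Amax B AB); split.
    - move=> y z [d Ad] [e Ae]; exists (d + e).
      by rewrite scalerDl opprD addrACA; apply: AD.
    - move=> a y [d Ad]; exists (a * d).
      by rewrite -scalerA -scalerBr; apply: AZ.
    - by move=> w [d Ad]; apply: contrapT => w0; apply: nB; exists w, d.
  have d0 : d != 0.
    by apply: contra_notN w0 => /eqP d0; apply: Aj; rewrite d0 scale0r subr0 in Ad.
  exists (d^-1 *: w); have := AZ (- d^-1) _ Ad.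
  by rewrite scalerBr scalerA mulNr mulVf// scaleN1r opprK addrC scaleNr jZ.
have uniq x v w : A (x - j v) -> A (x - j w) -> v = w.
  move=> Av Aw; apply/eqP; rewrite eq_sym -subr_eq0; apply/eqP/Aj.
  have -> : j (w - v) = x - j v + -1 *: (x - j w).
    by rewrite scaleN1r opprB jB [RHS]addrC addrA subrK.
  exact/AD/AZ.
have [r Ar] := choice ex; exists r; split.
  move=> a x y; apply: (uniq (a *: x + y)) => //.
  by rewrite lj opprD addrACA -scalerBr; apply/AD/Ar/AZ.
by move=> w; apply: (uniq (j w)) => //; rewrite subrr.
Qed.

Lemma linear_functional_neq0 (K : fieldType) (V : lmodType K) (v : V) :
  v != 0 -> exists f : V -> K,
    (forall a x y, f (a *: x + y) = a * f x + f y) /\ f v = 1.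
Proof.
move=> v0; pose j (c : K^o) := c *: v.
have lj : linear j by move=> a x y; rewrite /j scalerDl -scalerA.
have injj : injective j.
  move=> x y /eqP; rewrite /j -subr_eq0 -scalerBl scaler_eq0 (negbTE v0) orbF.
  by rewrite subr_eq0 => /eqP.
have [r [lr rK]] := linear_retraction lj injj; exists r; split=> //.
by rewrite -[v in r v]scale1r; apply: rK.
Qed.

Lemma tens_neq0 (K : fieldType) (I : Type) (V : I -> lmodType K)
    (e : forall i, V i) : (forall i, e i != 0) -> tens e != 0.
Proof.
move=> e0.
pose l i := sval (cid (linear_functional_neq0 (e0 i))).
have lP i : (forall a x y, l i (a *: x + y) = a * l i x + l i y) /\ l i (e i) = 1
  by exact: svalP (cid (linear_functional_neq0 (e0 i))).
pose D (y : forall i, V i) : set {classic I} := [set i | y i <> e i].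
pose pr (y : forall i, V i) : K := \big[*%R/1]_(i \in [set: {classic I}]) l i (y i).
pose f y : K^o := if `[< finite_set (D y) >] then pr y else 0.
have prE j y : finite_set (D y) ->
    pr y = l j (y j) * \big[*%R/1]_(i \in (D y `|` [set j]) `\ j) l i (y i).
  move=> fy; rewrite /pr -(@fsbig_widen _ _ _ _ (D y `|` [set j])) //=.
    by rewrite (fsbigD1 (j : {classic I}))//; [rewrite finite_setU; split | right].
  move=> i [_ /= /not_orP[/contrapT Dyi _]].
  by rewrite Dyi; have [_ ->] := lP i.
have mf : multilinear f.
  move=> j c x y z xyz zj.
  have DD u w : (forall i, i <> j -> u i = w i) ->
      D u `|` [set j] = D w `|` [set j].
    by move=> uw; apply/seteqP; split=> i /= [|->]; try (by right);
      have [->|ij] := pselect (i = j); try (by right);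
      rewrite /D /= => Di; left; rewrite ?uw// -?uw.
  have Dz w : (forall i, i <> j -> w i = z i) ->
      `[< finite_set (D w) >] = `[< finite_set (D z) >].
    move=> wz; apply/asbool_equiv_eq.
    have H u : finite_set (D u) <-> finite_set (D u `|` [set j]).
      rewrite finite_setU; split=> [fu|[]//]; split=> //; exact: finite_set1.
    by rewrite (H w) (H z) (DD w z).
  have xz i : i <> j -> x i = z i by move=> /xyz[].
  have yz i : i <> j -> y i = z i by move=> /xyz[].
  rewrite /f (Dz x xz) (Dz y yz); case: asboolP => [fz|_]; last first.
    by rewrite scaler0 addr0.
  have fx : finite_set (D x) by apply/asboolP; rewrite (Dz x xz); apply/asboolP.
  have fy : finite_set (D y) by apply/asboolP; rewrite (Dz y yz); apply/asboolP.
  rewrite !(prE j)// (DD x z)// (DD y z)//.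
  have [lj _] := lP j.
  rewrite zj lj mulrDl scalerAl; congr (_ * _ + _ * _);
    by apply: eq_fsbigr => i; rewrite inE => -[_ /= ij]; rewrite ?xz ?yz.
apply/negP => /eqP E.
have : tens_lift f (tens e) = 1.
  rewrite tens_lift_tens// /f; case: asboolP => [_|[]].
    by rewrite /pr fsbig1// => i _; have [_ ->] := lP i.
  by rewrite (_ : D e = set0)//; apply/seteqP; split=> i.
rewrite E [0](_ : _ = t0 V)// lift_t0// => /eqP.
by rewrite eq_sym oner_eq0.
Qed.

(* [W] with scalars acting through complex conjugation, so that linear maps   *)
(* to [conj_mod W] are the conjugate-linear maps to [W].                      *)
Definition conj_mod (C : numClosedFieldType) (W : lmodType C) : Type := W.

Section ConjMod.
Variables (C : numClosedFieldType) (W : lmodType C).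
HB.instance Definition _ := GRing.Zmodule.on (conj_mod W).
Definition conj_scale (a : C) (w : conj_mod W) : conj_mod W := a^* *: (w : W).
Lemma conj_scaleA a b v : conj_scale a (conj_scale b v) = conj_scale (a * b) v.
Proof. by rewrite /conj_scale scalerA rmorphM. Qed.
Lemma conj_scale1 : left_id 1 conj_scale.
Proof. by move=> v; rewrite /conj_scale rmorph1 scale1r. Qed.
Lemma conj_scaleDr : right_distributive conj_scale +%R.
Proof. by move=> a u v; rewrite /conj_scale scalerDr. Qed.
Lemma conj_scaleDl v : {morph conj_scale^~ v : a b / a + b}.
Proof. by move=> a b; rewrite /conj_scale rmorphD scalerDl. Qed.
HB.instance Definition _ := GRing.Zmodule_isLmodule.Build C (conj_mod W)
  conj_scaleA conj_scale1 conj_scaleDr conj_scaleDl.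
End ConjMod.

Section TensorAlgebra.
Variables (C : numClosedFieldType) (I : Type) (A : I -> starAlgType C).

Definition tensor_alg := tensor (fun i => A i : lmodType C).
HB.instance Definition _ := GRing.Lmodule.on tensor_alg.

Definition atens (x : forall i, A i) : tensor_alg :=
  tens (V := fun i => A i : lmodType C) x.

Definition alift (W : lmodType C) (f : (forall i, A i) -> W) (t : tensor_alg) :
  W := tens_lift (V := fun i => A i : lmodType C) f t.

Definition amultilinear (W : lmodType C) (f : (forall i, A i) -> W) :=
  multilinear (V := fun i => A i : lmodType C) f.

Lemma atens_multilinear : amultilinear atens.
Proof. exact: tens_multilinear. Qed.

Lemma alift_atens (W : lmodType C) (f : (forall i, A i) -> W) x :
  amultilinear f -> alift f (atens x) = f x.
Proof. by move=> mf; apply: tens_lift_tens. Qed.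

Lemma alift_linear (W : lmodType C) (f : (forall i, A i) -> W) :
  amultilinear f -> linear (alift f).
Proof. exact: tens_lift_linear. Qed.

Lemma atens_ind (P : tensor_alg -> Prop) : P 0 ->
  (forall s t, P s -> P t -> P (s + t)) -> (forall c s, P s -> P (c *: s)) ->
  (forall x, P (atens x)) -> forall t, P t.
Proof. exact: tens_ind. Qed.

(* Determined by (\otimes a_i)(\otimes b_i) = \otimes a_i b_i, see [tmul_tens]. *)
Definition tmul (s t : tensor_alg) : tensor_alg :=
  alift (fun a => alift (fun b => atens (fun i => a i * b i)) t) s.

Definition tone : tensor_alg := atens (fun=> 1).

(* Determined by (\otimes a_i)^* = \otimes a_i^*, see [tstar_tens]. *)
Definition tstar (t : tensor_alg) : tensor_alg :=
  alift (W := conj_mod tensor_alg) (fun a => atens (fun i => star (a i))) t.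

Lemma mul_multilinear_r a : amultilinear (fun b => atens (fun i => a i * b i)).
Proof.
move=> j c x y z xyz zj; apply: atens_multilinear; first by
  move=> i /xyz[-> ->].
by rewrite zj mulrDr scalerAr.
Qed.

Lemma mul_multilinear_l b : amultilinear (fun a => atens (fun i => a i * b i)).
Proof.
move=> j c x y z xyz zj; apply: atens_multilinear; first by
  move=> i /xyz[-> ->].
by rewrite zj mulrDl scalerAl.
Qed.

Lemma tmul_multilinear t :
  amultilinear (fun a => alift (fun b => atens (fun i => a i * b i)) t).
Proof.
move=> j c x y z xyz zj; rewrite /alift /tens_lift /lsum.
rewrite scaler_sumr -big_split; apply: eq_bigr => p _ /=.
rewrite (@mul_multilinear_l _ j c x y z xyz zj) scalerDr !scalerA.
by rewrite [p.1 * c]mulrC.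
Qed.

Lemma tmul_linear_l t : linear (tmul^~ t).
Proof. exact: alift_linear (tmul_multilinear t). Qed.

Lemma tmulE s t : tmul s t =
  \sum_(p <- (repr s : seq _))
     p.1 *: alift (fun b => atens (fun i => p.2 i * b i)) t.
Proof. by []. Qed.

Lemma tmul_linear_r s : linear (tmul s).
Proof.
move=> c t u; rewrite !tmulE scaler_sumr -big_split.
apply: eq_bigr => p _; rewrite (alift_linear (@mul_multilinear_r _)).
by rewrite scalerDr !scalerA [p.1 * c]mulrC.
Qed.

Lemma tmul_tens a b : tmul (atens a) (atens b) = atens (fun i => a i * b i).
Proof.
rewrite /tmul alift_atens; last exact: tmul_multilinear.
by rewrite alift_atens//; apply: mul_multilinear_r.
Qed.

Lemma tmulDl : left_distributive tmul +%R.
Proof. by move=> x y z; have := tmul_linear_l z 1 x y; rewrite !scale1r. Qed.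
Lemma tmulDr : right_distributive tmul +%R.
Proof. by move=> x y z; have := tmul_linear_r x 1 y z; rewrite !scale1r. Qed.
Lemma tmul0l x : tmul 0 x = 0.
Proof. by apply: (addrI (tmul 0 x)); rewrite -tmulDl !addr0. Qed.
Lemma tmul0r x : tmul x 0 = 0.
Proof. by apply: (addrI (tmul x 0)); rewrite -tmulDr !addr0. Qed.
Lemma tmulZl c x y : tmul (c *: x) y = c *: tmul x y.
Proof. by have := tmul_linear_l y c x 0; rewrite tmul0l !addr0. Qed.
Lemma tmulZr c x y : tmul x (c *: y) = c *: tmul x y.
Proof. by have := tmul_linear_r x c y 0; rewrite tmul0r !addr0. Qed.

Lemma tmulA : associative tmul.
Proof.
elim/atens_ind => [|s t E1 E2|c s E|x] y z; first by rewrite !tmul0l.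
- by rewrite !tmulDl E1 E2.
- by rewrite !tmulZl E.
elim/atens_ind: y => [|s t E1 E2|c s E|y].
- by rewrite !(tmul0l, tmul0r).
- by rewrite !(tmulDl, tmulDr) E1 E2.
- by rewrite !(tmulZl, tmulZr) E.
elim/atens_ind: z => [|s t E1 E2|c s E|z].
- by rewrite !tmul0r.
- by rewrite !tmulDr E1 E2.
- by rewrite !tmulZr E.
rewrite !tmul_tens; congr atens.
by apply: functional_extensionality_dep => i; rewrite mulrA.
Qed.

Lemma tmul1 : left_id tone tmul.
Proof.
elim/atens_ind => [|s t E1 E2|c s E|x]; first by rewrite tmul0r.
- by rewrite tmulDr E1 E2.
- by rewrite tmulZr E.
rewrite tmul_tens; congr atens.
by apply: functional_extensionality_dep => i; rewrite mul1r.
Qed.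

Lemma tmulr1 : right_id tone tmul.
Proof.
elim/atens_ind => [|s t E1 E2|c s E|x]; first by rewrite tmul0l.
- by rewrite tmulDl E1 E2.
- by rewrite tmulZl E.
rewrite tmul_tens; congr atens.
by apply: functional_extensionality_dep => i; rewrite mulr1.
Qed.

Lemma tone_neq0 : tone != 0.
Proof. by apply: tens_neq0 => i; exact: oner_neq0. Qed.

HB.instance Definition _ := GRing.Zmodule_isNzRing.Build tensor_alg
  tmulA tmul1 tmulr1 tmulDl tmulDr tone_neq0.

Lemma tscalerAl (c : C) (x y : tensor_alg) : c *: (x * y) = c *: x * y.
Proof. by rewrite -[LHS]tmulZl. Qed.
HB.instance Definition _ := GRing.Lmodule_isLalgebra.Build C tensor_alg tscalerAl.
Lemma tscalerAr (c : C) (x y : tensor_alg) : c *: (x * y) = x * (c *: y).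
Proof. by rewrite -[LHS]tmulZr. Qed.
HB.instance Definition _ := GRing.Lalgebra_isAlgebra.Build C tensor_alg tscalerAr.

Lemma star_multilinear :
  amultilinear (W := conj_mod tensor_alg) (fun a => atens (fun i => star (a i))).
Proof.
move=> j c x y z xyz zj; apply: atens_multilinear; first by
  move=> i /xyz[-> ->].
by rewrite zj starD starZ.
Qed.

Lemma tstar_tens a : tstar (atens a) = atens (fun i => star (a i)).
Proof. exact: (alift_atens _ star_multilinear). Qed.

Lemma tstar_semilinear c x y : tstar (c *: x + y) = c^* *: tstar x + tstar y.
Proof. exact: (alift_linear star_multilinear). Qed.

Lemma tstarD : {morph tstar : x y / x + y}.
Proof.
by move=> x y; have := tstar_semilinear 1 x y; rewrite rmorph1 !scale1r.
Qed.
Lemma tstar0 : tstar 0 = 0.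
Proof. by apply: (addrI (tstar 0)); rewrite -tstarD !addr0. Qed.
Lemma tstarZ c x : tstar (c *: x) = c^* *: tstar x.
Proof. by have := tstar_semilinear c x 0; rewrite tstar0 !addr0. Qed.
Lemma tstarK : involutive tstar.
Proof.
elim/atens_ind => [|s t E1 E2|c s E|x]; first by rewrite !tstar0.
- by rewrite !tstarD E1 E2.
- by rewrite !tstarZ E conjCK.
rewrite !tstar_tens; congr atens.
by apply: functional_extensionality_dep => i; rewrite starK.
Qed.
Lemma tstarM x y : tstar (x * y) = tstar y * tstar x.
Proof.
elim/atens_ind: x => [|s t E1 E2|c s E|x].
- by rewrite mul0r tstar0 mulr0.
- by rewrite mulrDl !tstarD E1 E2 mulrDr.
- by rewrite -scalerAl !tstarZ E scalerAr.
elim/atens_ind: y => [|s t E1 E2|c s E|y].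
- by rewrite mulr0 tstar0 mul0r.
- by rewrite mulrDr !tstarD E1 E2 mulrDl.
- by rewrite -scalerAr !tstarZ E scalerAl.
rewrite [x in tstar x]tmul_tens !tstar_tens [RHS]tmul_tens; congr atens.
by apply: functional_extensionality_dep => i; rewrite starM.
Qed.
HB.instance Definition _ :=
  Algebra_hasStar.Build C tensor_alg tstarK tstarD tstarZ tstarM.

Lemma atensM a b : atens a * atens b = atens (fun i => a i * b i).
Proof. exact: tmul_tens. Qed.
Lemma atens1 : atens (fun=> 1) = 1. Proof. by []. Qed.
Lemma atens_star a : star (atens a) = atens (fun i => star (a i)).
Proof. exact: tstar_tens. Qed.

End TensorAlgebra.

Section Center.
Variables (C : numClosedFieldType) (A : starAlgType C).

Definition central : pred A := fun z => `[< ring_center [set: A] z >].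

Lemma centralP z : reflect (forall y, z * y = y * z) (central z).
Proof.
apply: (iffP (asboolP _)) => [[_ cz] y|cz]; first exact: cz.
by split=> // y _; apply: cz.
Qed.

(* The centre Z(A), as a unital *-algebra. *)
Record center_alg : Type := Center { center_val :> A; _ : central center_val }.
HB.instance Definition _ := [isSub for center_val].
HB.instance Definition _ := [Choice of center_alg by <:].

Lemma central_subalg : GRing.subsemialg_closed central.
Proof.
split=> /=.
- by apply/centralP => y; rewrite mul1r mulr1.
- split; first by apply/centralP => y; rewrite mul0r mulr0.
  move=> x z /centralP cx /centralP cz.
  by apply/centralP => y; rewrite mulrDl mulrDr cx cz.
- by move=> c x /centralP cx; apply/centralP => y; rewrite -scalerAl cx scalerAr.
- move=> x z /centralP cx /centralP cz.
  by apply/centralP => y; rewrite -mulrA cz mulrA cx mulrA.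
Qed.
HB.instance Definition _ :=
  GRing.SubChoice_isSubAlgebra.Build C A central center_alg central_subalg.

Lemma central_star z : central z -> central (star z).
Proof.
by move=> /centralP cz; apply/centralP => y; rewrite -[y]starK -!starM cz.
Qed.

Definition center_star (z : center_alg) : center_alg := Center (central_star (valP z)).
Lemma center_starK : involutive center_star.
Proof. by move=> z; apply/val_inj/starK. Qed.
Lemma center_starD : {morph center_star : x y / x + y}.
Proof. by move=> x y; apply/val_inj/starD. Qed.
Lemma center_starZ (c : C) x : center_star (c *: x) = c^* *: center_star x.
Proof. by apply/val_inj/starZ. Qed.
Lemma center_starM x y : center_star (x * y) = center_star y * center_star x.
Proof. by apply/val_inj/starM. Qed.
HB.instance Definition _ := Algebra_hasStar.Build C center_alg
  center_starK center_starD center_starZ center_starM.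

End Center.

Section Unitary.
Variables (C : numClosedFieldType) (A : starAlgType C).

Definition unitary_set : set A := [set a | star a * a = 1 /\ a * star a = 1].

(* The unitary group U_A. *)
Record unitary : Type :=
  Unitary { unitary_val :> A; _ : `[< unitary_set unitary_val >] }.
HB.instance Definition _ := [isSub for unitary_val].
HB.instance Definition _ := [Choice of unitary by <:].

Lemma unitaryP (u : unitary) : unitary_set u.
Proof. exact/asboolP/(valP u). Qed.

Lemma star1 : star (1 : A) = 1.
Proof. by rewrite -[LHS]mulr1 -[X in _ * X]starK -starM mulr1 starK. Qed.

Lemma unitary1 : unitary_set 1.
Proof. by split; rewrite star1 mulr1. Qed.
Lemma unitaryM u v : unitary_set u -> unitary_set v -> unitary_set (u * v).
Proof.
move=> [u1 u2] [v1 v2]; split; rewrite starM mulrA.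
  by rewrite -[_ * _ * u]mulrA u1 mulr1.
by rewrite -[_ * _ * star v]mulrA v2 mulr1.
Qed.
Lemma unitaryV u : unitary_set u -> unitary_set (star u).
Proof. by move=> [u1 u2]; split; rewrite starK. Qed.

Definition uone : unitary := Unitary (asboolT unitary1).
Definition umul (u v : unitary) : unitary :=
  Unitary (asboolT (unitaryM (unitaryP u) (unitaryP v))).
Definition uinv (u : unitary) : unitary :=
  Unitary (asboolT (unitaryV (unitaryP u))).

Lemma umulA : associative umul.
Proof. by move=> u v w; apply/val_inj/mulrA. Qed.
Lemma umul1 : left_id uone umul.
Proof. by move=> u; apply/val_inj/mul1r. Qed.
Lemma umulr1 : right_id uone umul.
Proof. by move=> u; apply/val_inj/mulr1. Qed.
Lemma umulV : left_inverse uone uinv umul.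
Proof. by move=> u; apply/val_inj; case: (unitaryP u). Qed.
Lemma umulrV : right_inverse uone uinv umul.
Proof. by move=> u; apply/val_inj; case: (unitaryP u). Qed.
HB.instance Definition _ := isGroup.Build unitary
  umulA umul1 umulr1 umulV umulrV.

End Unitary.
Arguments unitary_set {C} A.

Definition almost_eq (I : Type) (X : I -> Type) (x y : forall i, X i) : Prop :=
  finite_set [set i | x i <> y i].

Section Omega.
Variables (C : numClosedFieldType) (I : Type) (A : I -> starAlgType C).

Definition unitaries := {classic forall i, unitary (A i)}.

Definition omega_rel (u v : unitaries) : bool := `[< almost_eq u v >].

Lemma omega_rel_refl : reflexive omega_rel.
Proof.
move=> u; apply/asboolP; rewrite /almost_eq (_ : [set _ | _] = set0)//.
by apply/seteqP; split=> i.
Qed.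
Lemma omega_rel_sym : symmetric omega_rel.
Proof.
move=> u v; apply/asboolP/asboolP; apply: sub_finite_set => i /= uv vu;
  exact: uv.
Qed.
Lemma omega_rel_trans : transitive omega_rel.
Proof.
move=> v u w /asboolP uv /asboolP vw; apply/asboolP.
have : finite_set ([set i | u i <> v i] `|` [set i | v i <> w i]).
  by rewrite finite_setU.
apply: sub_finite_set => i /= uw.
by have [uvi|] := pselect (u i = v i); [right; rewrite -uvi | left].
Qed.

Canonical omega_equiv :=
  EquivRel omega_rel omega_rel_refl omega_rel_sym omega_rel_trans.

(* Omega^ut_{I;A} *)
Definition Omega := {eq_quot omega_rel}.
HB.instance Definition _ := Choice.on Omega.

Definition omega_class (u : forall i, unitary (A i)) : Omega :=
  \pi_Omega (u : unitaries).

Lemma omega_classP u v : omega_class u = omega_class v <-> almost_eq u v.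
Proof. by split=> [/eqmodP/asboolP//|uv]; apply/eqmodP/asboolP. Qed.

Lemma omega_surj w : exists u, w = omega_class u.
Proof. by exists (repr w : unitaries); rewrite /omega_class reprK. Qed.

Lemma omega_repr u : almost_eq (repr (omega_class u) : unitaries) u.
Proof. by apply/omega_classP; rewrite /omega_class reprK. Qed.

Definition oone : Omega := omega_class (fun=> 1%g).
(* The operations are coordinatewise: see [omega_classM] and [omega_classV]. *)
Definition omul (v w : Omega) : Omega :=
  omega_class (fun i => (repr v : unitaries) i * (repr w : unitaries) i)%g.
Definition oinv (w : Omega) : Omega :=
  omega_class (fun i => ((repr w : unitaries) i)^-1)%g.

Lemma omul_class u v :
  omul (omega_class u) (omega_class v) = omega_class (fun i => u i * v i)%g.
Proof.
apply/omega_classP.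
have : finite_set
    ([set i | (repr (omega_class u) : unitaries) i <> u i] `|`
     [set i | (repr (omega_class v) : unitaries) i <> v i]).
  by rewrite finite_setU; split; apply: omega_repr.
apply: sub_finite_set => i /= uv.
have [E|] := pselect ((repr (omega_class u) : unitaries) i = u i); last by left.
by right=> E'; apply: uv; rewrite E E'.
Qed.

Lemma oinv_class u : oinv (omega_class u) = omega_class (fun i => (u i)^-1)%g.
Proof.
apply/omega_classP; apply: sub_finite_set (omega_repr u) => i /= uv E.
by apply: uv; rewrite E.
Qed.

Lemma omulA : associative omul.
Proof.
move=> x y z; have [u ->] := omega_surj x; have [v ->] := omega_surj y.
have [w ->] := omega_surj z; rewrite !omul_class; congr omega_class.
by apply: functional_extensionality_dep => i; rewrite mulgA.
Qed.
Lemma omul1 : left_id oone omul.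
Proof.
move=> x; have [u ->] := omega_surj x; rewrite omul_class; congr omega_class.
by apply: functional_extensionality_dep => i; rewrite mul1g.
Qed.
Lemma omulr1 : right_id oone omul.
Proof.
move=> x; have [u ->] := omega_surj x; rewrite omul_class; congr omega_class.
by apply: functional_extensionality_dep => i; rewrite mulg1.
Qed.
Lemma omulV : left_inverse oone oinv omul.
Proof.
move=> x; have [u ->] := omega_surj x; rewrite oinv_class omul_class.
congr omega_class.
by apply: functional_extensionality_dep => i; rewrite mulVg.
Qed.
Lemma omulrV : right_inverse oone oinv omul.
Proof.
move=> x; have [u ->] := omega_surj x; rewrite oinv_class omul_class.
congr omega_class.
by apply: functional_extensionality_dep => i; rewrite mulgV.
Qed.
HB.instance Definition _ := isGroup.Build Omega omulA omul1 omulr1 omulV omulrV.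

Lemma omega_classM u v :
  (omega_class u * omega_class v = omega_class (fun i => u i * v i))%g.
Proof. exact: omul_class. Qed.
Lemma omega_classV u : ((omega_class u)^-1 = omega_class (fun i => (u i)^-1))%g.
Proof. exact: oinv_class. Qed.
Lemma omega_class1 : (omega_class (fun=> 1) = 1)%g.
Proof. by []. Qed.

(* The subspace \bigotimes^w_i A_i. *)
Definition utensor_at (w : Omega) : set (tensor_alg A) :=
  lspan [set t | exists (u : forall i, unitary (A i)) (x : forall i, A i),
          [/\ w = omega_class u, almost_eq x (fun i => u i) & t = atens x]].

(* The sum of the subspaces \bigotimes^w_i A_i; it is direct by               *)
(* [utensor_direct] below.                                                    *)
Definition utensor : set (tensor_alg A) := lspan (\bigcup_w utensor_at w).

End Omega.
Arguments utensor {C I} A.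

Section CenterInclusion.
Variables (C : numClosedFieldType) (I : Type) (A : I -> starAlgType C).

Lemma unitary_of_center_subproof i (u : unitary (center_alg (A i))) :
  unitary_set (A i) (val (val u)).
Proof.
have [u1 u2] := unitaryP u; split.
  exact: (congr1 val u1).
exact: (congr1 val u2).
Qed.

Definition unitary_of_center i (u : unitary (center_alg (A i))) : unitary (A i) :=
  Unitary (asboolT (unitary_of_center_subproof u)).

(* The embedding of Omega^ut_{I;Z(A)} in Omega^ut_{I;A}. *)
Definition Omega_of_center (w : Omega (fun i => center_alg (A i))) : Omega A :=
  omega_class (fun i => unitary_of_center ((repr w : unitaries _) i)).

Lemma unitary_of_center_inj i : injective (@unitary_of_center i).
Proof. by move=> u v [uv]; do 2!apply/val_inj. Qed.

Lemma Omega_of_center_class u :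
  Omega_of_center (omega_class u) =
  omega_class (fun i => unitary_of_center (u i)).
Proof.
apply/omega_classP; apply: sub_finite_set (omega_repr u) => i /= uv E.
by apply: uv; rewrite E.
Qed.

Lemma Omega_of_center_inj : injective Omega_of_center.
Proof.
move=> v w; have [x ->] := omega_surj v; have [y ->] := omega_surj w.
rewrite !Omega_of_center_class => /omega_classP xy; apply/omega_classP.
by apply: sub_finite_set xy => i /= xy /unitary_of_center_inj.
Qed.

Lemma Omega_of_centerM v w :
  (Omega_of_center (v * w) = Omega_of_center v * Omega_of_center w)%g.
Proof.
have [x ->] := omega_surj v; have [y ->] := omega_surj w.
rewrite omega_classM !Omega_of_center_class omega_classM; congr omega_class.
by apply: functional_extensionality_dep => i; apply/val_inj.
Qed.

(* The canonical map from \bigotimes_i Z(A_i) to \bigotimes_i A_i. *)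
Definition tensor_of_center :
    tensor_alg (fun i => center_alg (A i)) -> tensor_alg A :=
  alift (fun z : forall i, center_alg (A i) => atens (fun i => center_val (z i))).

Lemma tensor_of_center_multilinear :
  amultilinear (fun z : forall i, center_alg (A i) => atens (fun i => center_val (z i))).
Proof.
move=> j c x y z xyz zj; apply: atens_multilinear; first by
  move=> i /xyz[-> ->].
by rewrite zj.
Qed.

Lemma tensor_of_center_linear : linear tensor_of_center.
Proof. exact: alift_linear tensor_of_center_multilinear. Qed.

Lemma tensor_of_center_atens z :
  tensor_of_center (atens z) = atens (fun i => center_val (z i)).
Proof. by apply: alift_atens; exact: tensor_of_center_multilinear. Qed.

Lemma tensor_of_centerM s t :
  tensor_of_center (s * t) = tensor_of_center s * tensor_of_center t.
Proof.
have lin := tensor_of_center_linear.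
have f0 : tensor_of_center 0 = 0.
  by have := lin (-1) 0 0; rewrite scaler0 addr0 scaleN1r addNr.
have fD x y : tensor_of_center (x + y) = tensor_of_center x + tensor_of_center y.
  by have := lin 1 x y; rewrite !scale1r.
have fZ c x : tensor_of_center (c *: x) = c *: tensor_of_center x.
  by have := lin c x 0; rewrite f0 !addr0.
elim/atens_ind: s => [|x y E1 E2|c x E|x].
- by rewrite mul0r f0 mul0r.
- by rewrite mulrDl !fD E1 E2 mulrDl.
- by rewrite -scalerAl !fZ E scalerAl.
elim/atens_ind: t => [|y z E1 E2|c y E|y].
- by rewrite mulr0 f0 mulr0.
- by rewrite mulrDr !fD E1 E2 mulrDr.
- by rewrite -scalerAr !fZ E scalerAr.
by rewrite atensM !tensor_of_center_atens atensM.
Qed.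

Lemma tensor_of_center_inj : injective tensor_of_center.
Proof.
have lval i : linear (@center_val C (A i)) by move=> a x y.
have ex i := linear_retraction (lval i) val_inj.
pose r i := sval (cid (ex i)).
have rP i : linear (r i) /\ cancel (@center_val C (A i)) (r i).
  exact: svalP (cid (ex i)).
pose g (x : forall i, A i) : tensor_alg (fun i => center_alg (A i)) :=
  atens (fun i => r i (x i)).
have mg : amultilinear g.
  move=> j c x y z xyz zj; apply: atens_multilinear; first by
    move=> i /xyz[-> ->].
  by rewrite zj; case: (rP j) => ->.
apply: (can_inj (g := alift g)) => t.
rewrite -[LHS]/((alift g \o tensor_of_center) t).
have -> // : alift g \o tensor_of_center =1 id.
apply: tens_linear_eq => // [a x y|x] /=.
  by rewrite tensor_of_center_linear alift_linear.
rewrite -/(atens x) tensor_of_center_atens alift_atens//; congr atens.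
by apply: functional_extensionality_dep => i; case: (rP i).
Qed.

End CenterInclusion.
Arguments Omega_of_center {C I} A.
Arguments tensor_of_center {C I} A.

Section UtensorFacts.
Variables (C : numClosedFieldType) (I : Type) (A : I -> starAlgType C).

Lemma utensor_atP (u : forall i, unitary (A i)) :
  utensor_at (omega_class u) =
  lspan [set t | exists x : forall i, A i,
          almost_eq x (fun i => u i) /\ t = atens x].
Proof.
congr lspan; apply/seteqP; split=> t /=; last first.
  by move=> [x [xu ->]]; exists u, x.
move=> [v [x [/omega_classP uv xv ->]]]; exists x; split=> //.
have : finite_set ([set i | u i <> v i] `|`
                   [set i | x i <> v i :> A i]) by rewrite finite_setU; split.
apply: sub_finite_set => i /= xu.
by have [uvi|] := pselect (u i = v i); [right; rewrite -uvi | left].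
Qed.

Lemma utensor_atens (u : forall i, unitary (A i)) (x : forall i, A i) :
  almost_eq x (fun i => u i) -> utensor A (atens x).
Proof.
move=> xu; apply: sub_lspan; exists (omega_class u) => //.
by rewrite utensor_atP; apply: sub_lspan; exists x.
Qed.

Lemma utensor_ind (P : tensor_alg A -> Prop) : P 0 ->
  (forall s t, P s -> P t -> P (s + t)) -> (forall c s, P s -> P (c *: s)) ->
  (forall (u : forall i, unitary (A i)) (x : forall i, A i),
     almost_eq x (fun i => u i) -> P (atens x)) ->
  forall t, utensor A t -> P t.
Proof.
move=> P0 PD PZ Pu; apply: lspan_min => // t [w _].
have [u ->] := omega_surj w; rewrite utensor_atP.
by apply: lspan_min => // _ [x [xu ->]]; apply: Pu xu.
Qed.

Lemma utensor0 : utensor A (0 : tensor_alg A). Proof. exact: lspan0. Qed.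
Lemma utensorD (s t : tensor_alg A) : utensor A s -> utensor A t -> utensor A (s + t).
Proof. exact: lspanD. Qed.
Lemma utensorZ c (t : tensor_alg A) : utensor A t -> utensor A (c *: t).
Proof. exact: lspanZ. Qed.

Lemma utensor1 : utensor A (1 : tensor_alg A).
Proof.
apply: (@utensor_atens (fun=> 1%g)).
by rewrite /almost_eq (_ : [set _ | _] = set0)//; apply/seteqP; split=> i.
Qed.

Lemma utensorM (s t : tensor_alg A) : utensor A s -> utensor A t -> utensor A (s * t).
Proof.
move=> Us Ut; elim/utensor_ind: s / Us => [|a b Ua Ub|c a Ua|u x xu].
- by rewrite mul0r; apply: utensor0.
- by rewrite mulrDl; apply: utensorD.
- by rewrite -scalerAl; apply: utensorZ.
elim/utensor_ind: t / Ut => [|a b Ua Ub|c a Ua|v y yv].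
- by rewrite mulr0; apply: utensor0.
- by rewrite mulrDr; apply: utensorD.
- by rewrite -scalerAr; apply: utensorZ.
rewrite atensM; apply: (@utensor_atens (fun i => u i * v i)%g).
have : finite_set ([set i | x i <> u i :> A i] `|` [set i | y i <> v i :> A i]).
  by rewrite finite_setU; split.
apply: sub_finite_set => i /= xy.
have [E|] := pselect (x i = u i); last by left.
by right=> E'; apply: xy; rewrite E E'.
Qed.

Lemma utensor_star (t : tensor_alg A) : utensor A t -> utensor A (star t).
Proof.
move=> Ut; elim/utensor_ind: t / Ut => [|a b Ua Ub|c a Ua|u x xu].
- by rewrite (_ : star 0 = 0)//; [apply: utensor0 | exact: tstar0].
- by rewrite starD; apply: utensorD.
- by rewrite starZ; apply: utensorZ.
rewrite atens_star; apply: (@utensor_atens (fun i => (u i)^-1)%g).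
by apply: sub_finite_set xu => i /= xu E; apply: xu; rewrite E.
Qed.

(* The subspaces [utensor_at w] are independent: a finite sum of       *)
(* elements of pairwise distinct summands vanishes only if each of them does. *)
Lemma utensor_direct n (w : 'I_n -> Omega A) (t : 'I_n -> tensor_alg A) :
  injective w -> (forall k, utensor_at (w k) (t k)) ->
  \sum_(k < n) t k = 0 -> forall k, t k = 0.
Proof.
move=> winj wt t0 k; have [u wu] := omega_surj (w k).
pose D (x : forall i, A i) := almost_eq x (fun i => u i).
pose f (x : forall i, A i) : tensor_alg A :=
  if `[< D x >] then atens x else 0.
have mf : amultilinear f.
  move=> j c x y z xyz zj.
  have E (v : forall i, A i) : (forall i, i <> j -> v i = z i) ->
      `[< D v >] = `[< D z >].
    move=> vz; apply/asbool_equiv_eq.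
    have H (s : forall i, A i) : D s <->
        finite_set ([set i | s i <> u i :> A i] `|` [set j]).
      rewrite finite_setU; split=> [fs|[]//]; split=> //; exact: finite_set1.
    rewrite (H v) (H z) (_ : _ `|` _ = [set i | z i <> u i :> A i] `|` [set j])//.
    apply/seteqP; split=> i /= [|->]; try (by right);
      have [->|ij] := pselect (i = j); try (by right);
      by move=> Di; left; rewrite ?vz// -?vz.
  rewrite /f (E x) ?(E y); [|by move=> i /xyz[]..].
  case: asboolP => _; last by rewrite scaler0 addr0.
  exact: atens_multilinear xyz zj.
have lf := alift_linear mf.
have f0 : alift f 0 = 0.
  by have := lf (-1) 0 0; rewrite scaler0 addr0 scaleN1r addNr.
have fD s r : alift f (s + r) = alift f s + alift f r.
  by have := lf 1 s r; rewrite !scale1r.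
have fZ c s : alift f (c *: s) = c *: alift f s.
  by have := lf c s 0; rewrite f0 !addr0.
have fw l : alift f (t l) = if l == k then t l else 0.
  have [v wv] := omega_surj (w l).
  have := wt l; rewrite wv utensor_atP; move: (t l).
  apply: lspan_min.
  - by rewrite /= f0 if_same.
  - by move=> x y /=; rewrite fD => -> ->; case: eqP; rewrite ?addr0.
  - by move=> a x /=; rewrite fZ => ->; case: eqP; rewrite ?scaler0.
  move=> _ [x [xv ->]] /=; rewrite alift_atens// /f.
  case: asboolP => [xu|nxu]; case: eqP => // lk.
    case: lk; apply: winj; rewrite wv wu; apply/omega_classP.
    have : finite_set ([set i | x i <> u i :> A i] `|`
                       [set i | x i <> v i :> A i]) by rewrite finite_setU; split.
    apply: sub_finite_set => i /= uv.
    have [E|] := pselect (x i = u i); last by left.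
    by right=> E'; apply: uv; apply/val_inj; rewrite /= -E -E'.
  case: nxu; move: wv; rewrite lk wu => /omega_classP uv.
  have : finite_set ([set i | u i <> v i] `|`
                     [set i | x i <> v i :> A i]) by rewrite finite_setU; split.
  apply: sub_finite_set => i /= xu.
  by have [uvi|] := pselect (u i = v i); [right; rewrite -uvi | left].
have := congr1 (alift f) t0; rewrite f0 (big_morph _ fD f0).
rewrite (bigD1 k)//= fw eqxx big1 ?addr0// => l lk.
by rewrite fw (negbTE lk).
Qed.

End UtensorFacts.

(* Main.v *)
Require Import Defs.
From HB Require Import structures.
From mathcomp Require Import all_boot all_order all_algebra.
From mathcomp Require Import all_classical all_reals.
From mathcomp Require Import complex.

Import Order.TTheory GRing.Theory Num.Theory.
Local Open Scope classical_set_scope.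
Local Open Scope ring_scope.

Set Implicit Arguments.
Unset Strict Implicit.
Unset Printing Implicit Defensive.

(* The class of [u] is central iff only finitely many [u i] fail to commute   *)
(* with all unitaries of [A i]: otherwise witnesses of non-commutation at     *)
(* these coordinates assemble into a class not commuting with it, and         *)
(* restricting the witnesses to infinitely many disjoint infinite sets of     *)
(* coordinates gives infinitely many conjugates.  Off [F0] the unitaries span,*)
(* so commuting with unitaries is centrality in [A i].                        *)
(* The components of a central [t] of \bigotimes^ut_i A_i are permuted by     *)
(* conjugation with unitary monomials; only finitely many are non-zero, so    *)
(* they sit at classes with finite conjugacy class, that is, central ones.    *)
(* Hence all but finitely many factors of the monomials in [t] may be taken   *)
(* central, and the remaining factors are made central one coordinate [j] at  *)
(* a time: writing t = \sum_k a_k (x) w_k with a_k in A_j and the w_k         *)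
(* independent, commutation of [t] with A_j forces each a_k to be central.    *)

(** Parts (a) and (b) rest on [group_centerP], which reads centrality of a class off its
    coordinates, and on [infinite_conjugacy_class]. Part (c) takes its group-theoretic input from
    [group_center_range] and [component_noncentral]. Its coordinatewise step is [central_slot]:
    there [t] is tested against every element of [A j], not only unitaries, because a pure tensor
    with one arbitrary factor and all others 1 lies in [utensor A]. Conversely, a pure tensor with
    central factors commutes with every pure tensor. *)

Lemma dep_choice (I : Type) (T : I -> Type) (P : forall i, T i -> Prop) :
  (forall i, exists y, P i y) -> exists f : forall i, T i, forall i, P i (f i).
Proof.
by move=> ex; exists (fun i => sval (cid (ex i))) => i; apply: svalP.
Qed.

Lemma lspan_commute (K : fieldType) (B : algType K) (S : set B) z :
  (forall u, S u -> z * u = u * z) -> forall y, lspan S y -> z * y = y * z.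
Proof.
move=> zS; apply: lspan_min => //=; first by rewrite mul0r mulr0.
  by move=> x y; rewrite mulrDl mulrDr => -> ->.
by move=> a x; rewrite -scalerAl -scalerAr => ->.
Qed.

Lemma infinite_set_seq (T : Type) (S : set T) :
  infinite_set S <-> exists f : nat -> T, injective f /\ forall n, S (f n).
Proof.
split=> [/infiniteP/card_leP[f]|[f [f_inj fS]] finS].
  exists (fun n => val (f (exist _ n (mem_set (I : setT n))))); split.
    by move=> m n /val_inj/(@inj _ _ _ f)-/(_ (in_setT _) (in_setT _))[].
  by move=> n; apply/set_mem/(valP (f _)).
apply: infinite_nat; have := finite_preimage (in2W f_inj) finS.
by apply: sub_finite_set => n _; apply: fS.
Qed.

(** * Centre and conjugacy classes of the group of unitary families *)

Section UnitaryClasses.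
Variables (C : numClosedFieldType) (I : Type) (A : I -> starAlgType C).
Implicit Types (u v : forall i, unitary (A i)).

Lemma almost_eq_sym (X : I -> Type) (x y : forall i, X i) :
  almost_eq x y -> almost_eq y x.
Proof. by apply: sub_finite_set => i /= xy E; apply: xy. Qed.

Lemma almost_eq_trans (X : I -> Type) (x y z : forall i, X i) :
  almost_eq x y -> almost_eq y z -> almost_eq x z.
Proof.
move=> xy yz; have : finite_set ([set i | x i <> y i] `|` [set i | y i <> z i]).
  by rewrite finite_setU.
apply: sub_finite_set => i /= xz.
by have [E|] := pselect (x i = y i); [right; rewrite -E | left].
Qed.

Definition noncentral_coords u : set I :=
  [set i | exists v : unitary (A i), (u i * v)%g <> (v * u i)%g].

(** Witnesses are chosen at all coordinates at once, with 1 where none exists, so that a single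
    family detects every non-central coordinate. *)
Lemma noncentral_witness u : exists v,
  [set i | (u i * v i)%g <> (v i * u i)%g] = noncentral_coords u.
Proof.
have [i|v vP] := @dep_choice I _ (fun i (v : unitary (A i)) =>
  noncentral_coords u i -> (u i * v)%g <> (v * u i)%g).
  have [[v uv]|nu] := pselect (noncentral_coords u i); first by exists v.
  by exists 1%g.
exists v; apply/seteqP; split=> i /=; last exact: vP.
by move=> uv; exists (v i).
Qed.

Lemma group_centerP u :
  group_center (Omega A) (omega_class u) <-> finite_set (noncentral_coords u).
Proof.
split=> [cu|fu w].
  have [v <-] := noncentral_witness u; apply/omega_classP.
  by rewrite -!omega_classM; apply: cu.
have [v ->] := omega_surj w; rewrite !omega_classM; apply/omega_classP.
by apply: sub_finite_set fu => i /= uv; exists (v i).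
Qed.

Lemma group_center_range (F0 : set I) : finite_set F0 ->
  (forall i, ~ F0 i -> lspan (unitary_set (A i)) = [set: A i]) ->
  group_center (Omega A) = range (Omega_of_center A).
Proof.
move=> fF0 AU; apply/seteqP; split=> w; last first.
  move=> [z _ <-] y; have [v ->] := omega_surj z.
  rewrite Omega_of_center_class; have [u ->] := omega_surj y.
  rewrite !omega_classM; congr omega_class.
  apply: functional_extensionality_dep => i; apply: val_inj => /=.
  exact/centralP/(valP (val (v i))).
have [u ->] := omega_surj w => /group_centerP fu.
(* At the finitely many exceptional coordinates [u i] is replaced by 1; elsewhere it commutes with a
   spanning set of [A i], hence is central. *)
have [i|v vP] := @dep_choice I _ (fun i (v : unitary (center_alg (A i))) =>
  ~ (F0 `|` noncentral_coords u) i -> unitary_of_center v = u i).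
  have [Fi|/not_orP[Fi ui]] := pselect ((F0 `|` noncentral_coords u) i).
    by exists 1%g.
  have cu : central (u i : A i).
    apply/centralP => y; have : lspan (unitary_set (A i)) y by rewrite AU.
    apply: lspan_commute => v /asboolT Uv; apply: contrapT => uv; apply: ui.
    by exists (Unitary Uv) => -[].
  have [u1 u2] := unitaryP (u i).
  have Uz : unitary_set (center_alg (A i)) (Center cu).
    by split; apply: val_inj.
  by exists (Unitary (asboolT Uz)) => _; apply: val_inj.
exists (omega_class v) => //; rewrite Omega_of_center_class.
apply/omega_classP; have : finite_set (F0 `|` noncentral_coords u).
  by rewrite finite_setU.
by apply: sub_finite_set => i /= uv; apply: contrapT => /vP.
Qed.

Lemma group_center_full (F0 : set I) : finite_set F0 ->
  (forall i, ~ F0 i -> lspan (unitary_set (A i)) = [set: A i]) ->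
  group_center (Omega A) = [set: Omega A] <->
  finite_set [set i | ~ (forall x y : A i, x * y = y * x)].
Proof.
move=> fF0 AU; split=> [cA|fA]; last first.
  apply/seteqP; split=> // w _; have [u ->] := omega_surj w.
  apply/group_centerP; apply: sub_finite_set fA => i /= [v uv] cA.
  by apply: uv; apply: val_inj; apply: cA.
(* A single class that is non-central at every coordinate whose unitary group is non-abelian; its
   centrality bounds the set of such coordinates. *)
have [i|u uP] := @dep_choice I _ (fun i (u : unitary (A i)) =>
  (exists u v : unitary (A i), (u * v)%g <> (v * u)%g) ->
  exists v : unitary (A i), (u * v)%g <> (v * u)%g).
  have [[u uP]|nu] :=
    pselect (exists u v : unitary (A i), (u * v)%g <> (v * u)%g).
    by exists u.
  by exists 1%g.
have /group_centerP fu : group_center (Omega A) (omega_class u) by rewrite cA.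
have : finite_set (F0 `|` noncentral_coords u) by rewrite finite_setU.
apply: sub_finite_set => i /= nA; have [|Fi] := pselect (F0 i); first by left.
right; apply: uP; apply: contrapT => /forallNP cU; apply: nA => x y.
have Ux : lspan (unitary_set (A i)) x by rewrite AU.
have Uy : lspan (unitary_set (A i)) y by rewrite AU.
apply: lspan_commute Uy => v Uv; apply/esym; apply: lspan_commute Ux => u' Uu.
have /forallNP/(_ (Unitary (asboolT Uv)))/contrapT := cU (Unitary (asboolT Uu)).
by case.
Qed.

Lemma omega_classJ u v :
  (omega_class u ^ omega_class v)%g = omega_class (fun i => u i ^ v i)%g.
Proof. by rewrite conjgE omega_classV (omega_classM u v) omega_classM. Qed.

(* Conjugating [u] by [v] only over a subset [S] of the non-central           *)
(* coordinates changes [u] exactly on [S], so that pairwise disjoint infinite *)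
(* sets [S] give distinct conjugates.                                         *)
Lemma infinite_conjugacy_class w : ~ group_center (Omega A) w ->
  infinite_set [set (w ^ g)%g | g in [set: Omega A]].
Proof.
have [u ->] := omega_surj w => /group_centerP/infinite_set_seq[f [f_inj fu]].
have [v uv] := noncentral_witness u.
(* The pairing [pickle] cuts the sequence [f] into infinitely many disjoint infinite pieces. *)
pose S (n : nat) : set I := [set f (pickle (n, m)) | m in [set: nat]].
have SP n m i : S n i -> S m i -> n = m.
  by move=> [k _ <-] [l _ /f_inj/(pcan_inj pickleK)[]].
have S_inf n : infinite_set (S n).
  apply/infinite_set_seq; exists (fun m => f (pickle (n, m))); split.
    by move=> k l /f_inj/(pcan_inj pickleK)[].
  by move=> m; exists m.
pose g n i : unitary (A i) := if `[< S n i >] then v i else 1%g.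
apply/infinite_set_seq; exists (fun n => omega_class u ^ omega_class (g n))%g.
split=> [n m|n]; last by exists (omega_class (g n)).
rewrite !omega_classJ => /omega_classP fin; apply: contrapT => nm.
(* On [S n] the family [g m] is 1, so there the two conjugates are [u i ^ v i] and [u i], which
   differ. *)
apply: (S_inf n); apply: sub_finite_set fin => i Sni /=.
rewrite /g (asboolT Sni) asboolF => [|/(SP n m i Sni)//]; rewrite conjg1 => uvu.
have [k _ ki] := Sni; have : noncentral_coords u i by rewrite -ki; apply: fu.
by rewrite -uv => nuv; apply: nuv; rewrite conjgC uvu.
Qed.

End UnitaryClasses.

(** * Dual functionals and shortest bilinear sums *)

Section LinearAlgebra.
Variable K : fieldType.

Lemma linear_morph (V W : lmodType K) (f : V -> W) : linear f ->
  [/\ f 0 = 0, {morph f : x y / x + y} & forall a x, f (a *: x) = a *: f x].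
Proof.
move=> lf.
have f0 : f 0 = 0 by have := lf (-1) 0 0; rewrite scaler0 addr0 scaleN1r addNr.
split=> // [x y|a x]; first by have := lf 1 x y; rewrite !scale1r.
by have := lf a x 0; rewrite f0 !addr0.
Qed.

Lemma linear_sum_comb (V W : lmodType K) (f : V -> W) n (c : 'I_n -> K)
    (x : 'I_n -> V) : linear f ->
  f (\sum_k c k *: x k) = \sum_k c k *: f (x k).
Proof.
case/linear_morph => f0 fD fZ; rewrite (big_morph f fD f0).
by apply: eq_bigr => k _; rewrite fZ.
Qed.

(** Independence makes the combination map from row vectors to [W] injective; the coordinates of a
    linear retraction are the dual functionals. *)
Lemma dual_family (W : lmodType K) n (w : 'I_n -> W) :
  (forall c : 'I_n -> K, \sum_k c k *: w k = 0 -> forall k, c k = 0) ->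
  exists phi : 'I_n -> W -> K^o, (forall k, linear (phi k)) /\
    forall k l, phi k (w l) = (k == l)%:R.
Proof.
move=> w_free; pose j (c : 'rV[K]_n) := \sum_k c 0 k *: w k.
have lj : linear j.
  move=> a x y; rewrite /j scaler_sumr -big_split; apply: eq_bigr => k _.
  by rewrite !mxE scalerDl scalerA.
have [j0 jD jZ] := linear_morph lj.
have j_inj : injective j.
  move=> x y xy; apply/eqP; rewrite -subr_eq0; apply/eqP/rowP => k.
  rewrite [RHS]mxE; apply: (w_free (fun k => (x - y) 0 k)).
  by rewrite -[LHS]/(j (x - y)) jD -scaleN1r jZ scaleN1r xy subrr.
have [r [lr rK]] := linear_retraction lj j_inj.
exists (fun k x => r x 0 k); split=> [k a x y|k l]; first by rewrite lr !mxE.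
have -> : w l = j (delta_mx 0 l).
  rewrite /j (bigD1 l)//= mxE !eqxx scale1r big1 ?addr0// => i il.
  by rewrite mxE (negPf il) andbF scale0r.
by rewrite rK mxE.
Qed.

(* If [c] is a relation between the [w k] with [c l != 0] then the summand    *)
(* [B (v l) (w l)] can be absorbed into the others, so that a representation  *)
(* with the least number of summands has independent [w k].                   *)
Lemma bilinear_sum_free (V W T : lmodType K) (B : V -> W -> T) (S : set W) t n :
  (forall w, linear (B^~ w)) -> (forall v, linear (B v)) ->
  (exists v w, (forall k : 'I_n, S (w k)) /\ t = \sum_k B (v k) (w k)) ->
  exists m (v : 'I_m -> V) (w : 'I_m -> W),
    [/\ forall k, S (w k), t = \sum_k B (v k) (w k) &
        forall c : 'I_m -> K, \sum_k c k *: w k = 0 -> forall k, c k = 0].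
Proof.
move=> Bl Br; elim: n => [|n IH] [v [w [Sw tE]]].
  by exists 0%N, v, w; split=> // c _ [].
have [[c [c0 [l cl]]]|nc] := pselect (exists c : 'I_n.+1 -> K,
    \sum_k c k *: w k = 0 /\ exists l, c l != 0); last first.
  exists n.+1, v, w; split=> // c c0 k; apply/eqP/negP => /negP ck.
  by apply: nc; exists c; split=> //; exists k.
apply: IH; exists (fun k => v (lift l k) - (c (lift l k) / c l) *: v l).
exists (fun k => w (lift l k)); split=> //.
have wl : w l = \sum_k (- (c (lift l k) / c l)) *: w (lift l k).
  move: c0; rewrite (bigD1_ord l)//= => /(canRL (addrK _)).
  rewrite sub0r => /(congr1 ( *:%R (c l)^-1)).
  rewrite scalerA mulVf// scale1r => ->; rewrite -sumrN scaler_sumr.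
  apply: eq_bigr => k _; rewrite scalerN scalerA scaleNr.
  by rewrite [_^-1 * _]mulrC.
rewrite tE (bigD1_ord l)//= {1}wl linear_sum_comb// -big_split.
apply: eq_bigr => k _ /=.
have [_ BD BZ] := linear_morph (Bl (w (lift l k))).
by rewrite BD -[in RHS]scaleNr BZ addrC.
Qed.

End LinearAlgebra.

(** * Tensors with one distinguished factor *)

Section Tensors.
Variables (C : numClosedFieldType) (I : Type) (A : I -> starAlgType C).
Implicit Types (u v : forall i, unitary (A i)) (x y z : forall i, A i).

Definition upd x (j : I) (a : A j) : forall i, A i :=
  @dfwith {classic I} (fun i => A i) x j a.

Lemma updE x j a : upd x a j = a. Proof. exact: dfwithin. Qed.
Lemma upd_out x j a i : i <> j -> upd x (j := j) a i = x i.
Proof. by move=> ij; apply: dfwithout; apply/eqP => E; apply: ij. Qed.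

Lemma updP (P : forall i, A i -> Prop) x j a :
  P j a -> (forall i, i <> j -> P i (x i)) ->
  forall i, P i (upd x (j := j) a i).
Proof.
move=> Pa Px i; have [->|ij] := pselect (i = j); first by rewrite updE.
by rewrite upd_out//; apply: Px.
Qed.

Lemma almost_eq_upd x j (a : A j) : almost_eq (upd x a) x.
Proof.
apply: sub_finite_set (finite_set1 j) => i /= xi; apply: contrapT => ij.
by apply: xi; rewrite upd_out.
Qed.

Lemma agree_off_almost_eq x y j :
  (forall i, i <> j -> x i = y i) -> almost_eq x y.
Proof.
move=> xy; apply: sub_finite_set (finite_set1 j) => i /= xi.
by apply: contrapT => ij; apply: xi; apply: xy.
Qed.

Definition slot j (a : A j) : tensor_alg A := atens (upd (fun=> 1) a).

Lemma slot_linear j : linear (@slot j).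
Proof.
move=> c a b; apply: (@atens_multilinear _ _ _ j); last by rewrite !updE.
by move=> i ij; rewrite !upd_out.
Qed.

Lemma slotM j (a b : A j) : slot a * slot b = slot (a * b).
Proof.
rewrite atensM; congr atens; apply: functional_extensionality_dep.
move=> i; have [->|ij] := pselect (i = j); first by rewrite !updE.
by rewrite !upd_out// mulr1.
Qed.

Lemma slot_atens j (a : A j) x : slot a * atens x = atens (upd x (a * x j)).
Proof.
rewrite atensM; congr atens; apply: functional_extensionality_dep.
move=> i; have [->|ij] := pselect (i = j); first by rewrite !updE.
by rewrite !upd_out// mul1r.
Qed.

Lemma atens_slot j (a : A j) x : atens x * slot a = atens (upd x (x j * a)).
Proof.
rewrite atensM; congr atens; apply: functional_extensionality_dep.
move=> i; have [->|ij] := pselect (i = j); first by rewrite !updE.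
by rewrite !upd_out// mulr1.
Qed.

Lemma utensor_slot j (a : A j) : utensor A (slot a).
Proof.
by apply: (@utensor_atens _ _ _ (fun=> 1%g)); apply: almost_eq_upd.
Qed.

(* [id (x) phi], where [phi] acts on the factors other than the [j]-th one    *)
(* through the identification of their tensor product with the span of the    *)
(* [atens x] such that [x j = 1].                                             *)
Definition slice j (phi : tensor_alg A -> C^o) : tensor_alg A -> A j :=
  alift (fun x => phi (atens (upd x (1 : A j))) *: x j).

Lemma slice_multilinear j (phi : tensor_alg A -> C^o) : linear phi ->
  amultilinear (fun x => phi (atens (upd x (1 : A j))) *: x j).
Proof.
(* If [l] is [j], the scalar factor does not depend on the variable; otherwise the vector factor
   does not. *)
move=> lphi l c x y z xyz zl; have [jl|jl] := pselect (j = l).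
  have E t : (forall i, i <> l -> t i = z i) ->
      upd t (1 : A j) = upd z (1 : A j).
    move=> tz; apply: functional_extensionality_dep => i.
    have [->|ij] := pselect (i = j); first by rewrite !updE.
    by rewrite !upd_out// tz// -jl.
  rewrite (E x) ?(E y); [|by move=> i /xyz[]..].
  by subst l; rewrite zl scalerDr !scalerA [c * _]mulrC.
have [-> ->] := xyz j jl; rewrite scalerA -scalerDl; congr (_ *: _).
rewrite -[c * _]/(c *: (phi _ : C^o)) -lphi; congr phi.
apply: (@atens_multilinear _ _ _ l) => [i il|].
  have [->|ij] := pselect (i = j); first by rewrite !updE.
  by rewrite !upd_out//; apply: xyz.
by rewrite !upd_out//; apply/nesym.
Qed.

Lemma slice_slot j phi (a : A j) x : linear phi -> x j = 1 ->
  slice j phi (slot a * atens x) = phi (atens x) *: a.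
Proof.
move=> lphi xj; rewrite slot_atens /slice alift_atens; last first.
  exact: slice_multilinear.
rewrite updE xj mulr1; congr (phi (atens _) *: _).
apply: functional_extensionality_dep => i.
have [->|ij] := pselect (i = j); first by rewrite updE xj.
by rewrite !upd_out.
Qed.

(* With [w k] linearly independent, slicing [t * slot a = slot a * t] along   *)
(* the dual functionals gives [v k * a = a * v k].                            *)
Lemma central_slot j (S : set (tensor_alg A)) t :
  (S `<=` [set atens x | x in [set x | x j = 1]]) ->
  (forall a : A j, t * slot a = slot a * t) ->
  lspan [set s | exists (a : A j) w, S w /\ s = slot a * w] t ->
  lspan [set s | exists (a : A j) w, [/\ central a, S w & s = slot a * w]] t.
Proof.
move=> S1 ct [n [c [s [Ss tE]]]].
have Bl w : linear (fun a : A j => slot a * w).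
  by move=> b x y; rewrite slot_linear mulrDl scalerAl.
have Br (a : A j) : linear ( *%R (slot a)).
  by move=> b x y; rewrite mulrDr scalerAr.
have [a aP] := choice Ss; have [w wP] := choice aP.
have tE' : t = \sum_k slot (c k *: a k) * w k.
  rewrite tE; apply: eq_bigr => k _; have [_ ->] := wP k.
  by have [_ _ ->] := linear_morph (@slot_linear j); rewrite scalerAl.
have {a w aP wP tE tE'} [k [a [w [Sw tE w_free]]]] := bilinear_sum_free Bl Br
  (ex_intro _ _ (ex_intro _ w (conj (fun k => proj1 (wP k)) tE'))).
have [phi [lphi phiE]] := dual_family w_free.
have slice_tsum l (b : 'I_k -> A j) :
    slice j (phi l) (\sum_m slot (b m) * w m) = b l.
  have lin : linear (slice j (phi l)).
    by apply: alift_linear; apply: slice_multilinear.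
  have [f0 fD _] := linear_morph lin.
  rewrite (big_morph _ fD f0) (bigD1 l)//= big1 ?addr0 => [|m ml].
    have [x xj wx] := S1 _ (Sw l).
    by rewrite -wx slice_slot// wx phiE eqxx scale1r.
  have [x xj wx] := S1 _ (Sw m).
  by rewrite -wx slice_slot// wx phiE eq_sym (negPf ml) scale0r.
(* The [j]-th factor of [w m] is 1. *)
have slotw (b : A j) m : w m * slot b = slot b * w m.
  have [x xj <-] := S1 _ (Sw m).
  by rewrite slot_atens atens_slot xj mul1r mulr1.
exists k, (fun=> 1), (fun m => slot (a m) * w m); split=> [m|].
  exists (a m), (w m); split=> //; apply/centralP => b.
  rewrite -(slice_tsum m (fun m => a m * b)) -(slice_tsum m (fun m => b * a m)).
  congr slice; transitivity (t * slot b).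
    rewrite tE mulr_suml; apply: eq_bigr => l _.
    by rewrite -mulrA slotw mulrA slotM.
  by rewrite ct tE mulr_sumr; apply: eq_bigr => l _; rewrite mulrA slotM.
by rewrite tE; apply: eq_bigr => m _; rewrite scale1r.
Qed.

(** * Components of a tensor and conjugation by unitary monomials *)

Definition near_class (w : Omega A) x : Prop :=
  exists u, w = omega_class u /\ almost_eq x (fun i => u i).

Lemma near_almost_eq w x y : almost_eq x y -> near_class w x -> near_class w y.
Proof.
move=> xy [u [wu xu]]; exists u; split=> //.
exact: almost_eq_trans (almost_eq_sym xy) xu.
Qed.

Lemma near_uniq w w' x : near_class w x -> near_class w' x -> w = w'.
Proof.
move=> [u [-> xu]] [v [-> xv]]; apply/omega_classP.
apply: sub_finite_set (almost_eq_trans (almost_eq_sym xu) xv) => i /= uv E.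
by apply: uv; apply: val_inj.
Qed.

(* The projection onto [utensor_at w]. *)
Definition component (w : Omega A) : tensor_alg A -> tensor_alg A :=
  alift (fun x => if `[< near_class w x >] then atens x else 0).

Lemma component_multilinear w :
  amultilinear (fun x => if `[< near_class w x >] then atens x else 0).
Proof.
move=> j c x y z xyz zj.
have E t : (forall i, i <> j -> t i = z i) ->
    `[< near_class w t >] = `[< near_class w z >].
  move=> /agree_off_almost_eq tz; apply/asbool_equiv_eq.
  by split; apply: near_almost_eq => //; apply: almost_eq_sym.
rewrite (E x) ?(E y); [|by move=> i /xyz[]..].
case: asboolP => _; last by rewrite scaler0 addr0.
exact: atens_multilinear xyz zj.
Qed.

Lemma component_linear w : linear (component w).
Proof. by apply: alift_linear; apply: component_multilinear. Qed.

Lemma component_atens w x :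
  component w (atens x) = if `[< near_class w x >] then atens x else 0.
Proof. by rewrite /component alift_atens//; apply: component_multilinear. Qed.

Lemma utensor_component_sum t : utensor A t ->
  exists2 r : seq (Omega A), uniq r &
  (forall w, w \notin r -> component w t = 0) /\
  t = \sum_(w <- r) component w t.
Proof.
move=> Ut.
(* Summing over any duplicate-free list containing [r] lets the induction merge the lists of two
   summands. *)
suff [r [r0 rE]] : exists r : seq (Omega A),
    (forall w, w \notin r -> component w t = 0) /\
    (forall r' : seq (Omega A), uniq r' -> {subset r <= r'} ->
       t = \sum_(w <- r') component w t).
  exists (undup r); first exact: undup_uniq.
  split=> [w|]; first by rewrite mem_undup; apply: r0.
  by apply: rE => [|w]; rewrite ?undup_uniq// mem_undup.
elim/utensor_ind: t / Ut
  => [|s t [r [r0 rE]] [q [q0 qE]]|c t [r [r0 rE]]|u x xu].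
- exists [::]; split=> [w _|r' _ _].
    by have [-> _ _] := linear_morph (component_linear w).
  by rewrite big1// => w _; have [-> _ _] := linear_morph (component_linear w).
- exists (r ++ q); split=> [w|r' ur' sub].
    rewrite mem_cat negb_or => /andP[wr wq].
    by have [_ -> _] := linear_morph (component_linear w);
      rewrite r0// q0// addr0.
  transitivity (\sum_(w <- r') component w s + \sum_(w <- r') component w t).
    congr (_ + _); [apply: rE | apply: qE] => // w wr; apply: sub;
      by rewrite mem_cat wr ?orbT.
  rewrite -big_split; apply: eq_bigr => w _.
  by have [_ -> _] := linear_morph (component_linear w).
- exists r; split=> [w wr|r' ur' sub].
    by have [_ _ ->] := linear_morph (component_linear w); rewrite r0// scaler0.
  transitivity (c *: \sum_(w <- r') component w t); first by rewrite -rE.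
  rewrite scaler_sumr; apply: eq_bigr => w _.
  by have [_ _ ->] := linear_morph (component_linear w).
have xn : near_class (omega_class u) x by exists u.
exists [:: omega_class u]; split=> [w|r' ur' sub].
  rewrite inE component_atens; case: asboolP => // wx.
  by rewrite (near_uniq wx xn) eqxx.
rewrite (bigD1_seq (omega_class u))//=; last by apply: sub; rewrite inE.
rewrite component_atens asboolT// big1 ?addr0// => w wu.
rewrite component_atens; case: asboolP => // wx.
by rewrite (near_uniq wx xn) eqxx in wu.
Qed.

Definition umonomial u : tensor_alg A := atens (fun i => u i).

Lemma umonomialV u : umonomial (fun i => (u i)^-1)%g * umonomial u = 1.
Proof.
rewrite atensM -atens1; congr atens; apply: functional_extensionality_dep => i.
by case: (unitaryP (u i)).
Qed.

Lemma near_conj w x v : near_class w x <->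
  near_class (w ^ omega_class v)%g
    (fun i => unitary_val (v i)^-1%g * (x i * unitary_val (v i))).
Proof.
split=> [[u [-> xu]]|[u [wu xu]]].
  exists (fun i => u i ^ v i)%g; rewrite omega_classJ; split=> //.
  by apply: sub_finite_set xu => i /= xu E; apply: xu; rewrite E.
exists (fun i => u i ^ (v i)^-1)%g; split.
  by rewrite -omega_classJ -wu -omega_classV conjgK.
apply: sub_finite_set xu => i /= xu E; apply: xu => /=.
have [v1 v2] := unitaryP (v i).
by rewrite starK -E 2!mulrA v2 mul1r -mulrA v2 mulr1.
Qed.

Lemma component_conj w v t :
  component (w ^ omega_class v)%g
    (umonomial (fun i => (v i)^-1)%g * (t * umonomial v)) =
  umonomial (fun i => (v i)^-1)%g * (component w t * umonomial v).
Proof.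
have [f0 fD fZ] := linear_morph (component_linear w).
have [g0 gD gZ] := linear_morph (component_linear (w ^ omega_class v)%g).
elim/atens_ind: t => [|s t E1 E2|c t E|x].
- by rewrite f0 !mul0r mulr0 g0.
- by rewrite fD !mulrDl !mulrDr gD E1 E2.
- by rewrite fZ -!scalerAl -!scalerAr gZ E.
rewrite !atensM !component_atens (asbool_equiv_eq (near_conj w x v)).
by case: asboolP; rewrite ?atensM// mul0r mulr0.
Qed.

(** Conjugation by a unitary monomial fixes [t], so a non-zero component at [w] would give one at
    each of infinitely many conjugates of [w]. *)
Lemma component_noncentral t w : ring_center (utensor A) t ->
  ~ group_center (Omega A) w -> component w t = 0.
Proof.
move=> [Ut ct] /infinite_conjugacy_class conj_inf.
apply: contrapT => wt; apply: conj_inf.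
have [r _ [r0 _]] := utensor_component_sum Ut.
apply: sub_finite_set (finite_seq r) => _ [g _ <-] /=.
have [v ->] := omega_surj g; apply: contraT => /r0 E; exfalso; apply: wt.
have Uv u : utensor A (umonomial u).
  by apply: (@utensor_atens _ _ _ u);
    apply: sub_finite_set (finite_set0 _) => i.
have := component_conj w v t.
rewrite (ct _ (Uv v)) [_ * (_ * t)]mulrA umonomialV mul1r E.
move=> /esym/(congr1 (fun s =>
  umonomial v * s * umonomial (fun i => (v i)^-1)%g)).
have Vv : umonomial v * umonomial (fun i => (v i)^-1)%g = 1.
  rewrite -[RHS](umonomialV (fun i => (v i)^-1)%g); congr (umonomial _ * _).
  by apply: functional_extensionality_dep => i; rewrite invgK.
by rewrite mulr0 mul0r !mulrA Vv mul1r -mulrA Vv mulr1.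
Qed.

(** * Making all factors of a central tensor central *)

Definition near_center x : Prop :=
  exists u : forall i, unitary (center_alg (A i)),
    almost_eq x (fun i => unitary_of_center (u i)).

Lemma near_center_almost_eq x y :
  almost_eq x y -> near_center x -> near_center y.
Proof.
move=> xy [u xu]; exists u; exact: almost_eq_trans (almost_eq_sym xy) xu.
Qed.

Lemma center_near_center t :
  group_center (Omega A) = range (Omega_of_center A) ->
  ring_center (utensor A) t ->
  lspan [set atens x | x in near_center] t.
Proof.
move=> ZO ct; have [r _ [_ ->]] := utensor_component_sum (proj1 ct).
apply: big_ind => [||w _]; [exact: lspan0 | exact: lspanD |].
have [|nw] := pselect (group_center (Omega A) w); last first.
  by rewrite (component_noncentral ct nw); apply: lspan0.
rewrite ZO => -[z _ <-]; have [u ->] := omega_surj z.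
rewrite Omega_of_center_class; set v := omega_class _.
have [f0 fD fZ] := linear_morph (component_linear v).
elim/atens_ind: t {ct} => [|s t Ps Pt|c t Pt|x].
- by rewrite f0; apply: lspan0.
- by rewrite fD; apply: lspanD.
- by rewrite fZ; apply: lspanZ.
rewrite component_atens; case: asboolP => [[v' [/omega_classP uv xv]]|_].
  apply: sub_lspan; exists x => //; exists u; apply: almost_eq_trans xv _.
  by apply: sub_finite_set uv => i /= vu E; apply: vu; rewrite -E.
exact: lspan0.
Qed.

Definition central_off (F : set I) : set (forall i, A i) :=
  [set x | near_center x /\ forall i, ~ F i -> central (x i)].

(** Each monomial has finitely many exceptional factors, and [t] involves finitely many monomials;
    the list [s] collects their coordinates. *)
Lemma near_center_finite t : lspan [set atens x | x in near_center] t ->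
  exists s : seq {classic I},
    lspan [set atens x | x in central_off [set i | i \in s]] t.
Proof.
have mono (s s' : seq {classic I}) : {subset s <= s'} ->
    lspan [set atens x | x in central_off [set i | i \in s]] `<=`
    lspan [set atens x | x in central_off [set i | i \in s']].
  move=> ss'; apply: lspan_min; [exact: lspan0|exact: lspanD|exact: lspanZ|].
  move=> _ [x [nx cx] <-]; apply: sub_lspan; exists x => //; split=> // i si.
  by apply: cx => /ss'.
apply: (@lspan_min _ _ _ [set t | exists s : seq {classic I}, _ t]) => /=.
- by exists [::]; apply: lspan0.
- move=> x y [s sx] [q qy]; exists (s ++ q); apply: lspanD.
    by apply: mono sx => i; rewrite mem_cat => ->.
  by apply: mono qy => i; rewrite mem_cat => ->; rewrite orbT.
- by move=> a x [s sx]; exists s; apply: lspanZ.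
move=> _ [x nx <-]; have [u xu] := nx.
have [s sE] : exists s : seq {classic I},
    [set i : {classic I} | x i <> unitary_of_center (u i)] = [set` s].
  exact/finite_seqP.
exists s; apply: sub_lspan; exists x => //; split=> // i.
rewrite -[mkset _ i]/([set` s] i) -sE => /contrapT ->.
exact: (valP (val (u i))).
Qed.

(** Each monomial splits as [slot (x j)] times a monomial with [j]-th factor 1; [central_slot] makes
    the first factor central, and the product is again a monomial. *)
Lemma central_off_remove (j : {classic I}) (s : seq {classic I}) t :
  (forall a : A j, t * slot a = slot a * t) ->
  lspan [set atens x | x in central_off [set i | i \in j :: s]] t ->
  lspan [set atens x | x in central_off [set i | i \in s]] t.
Proof.
move=> ct tE.
pose S := [set atens x | x in
  [set x | central_off [set i | i \in j :: s] x /\ x j = 1]].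
have : lspan [set s | exists (a : A j) w,
    [/\ central a, S w & s = slot a * w]] t.
  apply: (central_slot _ ct) => [_ [x [_ xj] <-]|]; first by exists x.
  move: t tE {ct}.
  apply: lspan_min; [exact: lspan0|exact: lspanD|exact: lspanZ|].
  move=> _ [x [nx cx] <-]; apply: sub_lspan; exists (x j).
  exists (atens (upd x (1 : A j))); split.
    exists (upd x (1 : A j)) => //; split; last by rewrite updE.
    split.
      exact: near_center_almost_eq (almost_eq_sym (almost_eq_upd _ _)) nx.
    apply: (updP (P := fun i a => ~ (i \in j :: s) -> central a)) => [|i _].
      by move=> _; apply/centralP => y; rewrite mul1r mulr1.
    exact: cx.
  rewrite slot_atens updE mulr1; congr atens.
  apply: functional_extensionality_dep => i.
  have [->|ij] := pselect (i = j); first by rewrite updE.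
  by rewrite !upd_out.
apply: lspan_min; [exact: lspan0|exact: lspanD|exact: lspanZ|].
move=> _ [a [_ [ca [x [[nx cx] xj] <-] ->]]]; rewrite slot_atens xj mulr1.
apply: sub_lspan; exists (upd x a) => //; split.
  exact: near_center_almost_eq (almost_eq_sym (almost_eq_upd _ _)) nx.
apply: (updP (P := fun i a => ~ (i \in s) -> central a)) => [//|i ij si].
by apply: cx => /=; rewrite inE => /orP[/eqP|].
Qed.

Lemma center_central_monomials t :
  group_center (Omega A) = range (Omega_of_center A) ->
  ring_center (utensor A) t ->
  lspan [set atens x | x in central_off set0] t.
Proof.
move=> ZO ct; have [s] := near_center_finite (center_near_center ZO ct).
elim: s => [|j s IH] tE; last first.
  apply: IH; apply: central_off_remove tE => a.
  by case: ct => _; apply; apply: utensor_slot.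
by rewrite (_ : set0 = [set i | i \in ([::] : seq {classic I})])//;
  apply/seteqP; split.
Qed.

Lemma utensor_center :
  group_center (Omega A) = range (Omega_of_center A) ->
  ring_center (utensor A) =
  tensor_of_center A @` utensor (fun i => center_alg (A i)).
Proof.
move=> ZO; have [f0 fD fZ] := linear_morph (@tensor_of_center_linear _ _ A).
apply/seteqP; split=> [t /(center_central_monomials ZO)|_ [z Uz <-]].
  move: t; apply: lspan_min => /=.
  - by exists 0; [exact: utensor0 | exact: f0].
  - move=> _ _ [x Ux <-] [y Uy <-]; exists (x + y); last exact: fD.
    exact: utensorD.
  - by move=> a _ [x Ux <-]; exists (a *: x); [exact: utensorZ | exact: fZ].
  move=> _ [x [[u xu] cx] <-].
  exists (atens (fun i => Center (cx i (fun n => n)))).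
    apply: (@utensor_atens _ _ _ u); apply: sub_finite_set xu => i /= xu E.
    by apply: xu; apply: val_inj.
  by rewrite tensor_of_center_atens.
elim/utensor_ind: z / Uz => [|s t [Us cs] [Ut ct]|c t [Ut ct]|u x xu].
- by rewrite f0; split=> [|y _]; [exact: utensor0 | rewrite mul0r mulr0].
- rewrite fD; split=> [|y Uy]; first exact: utensorD.
  by rewrite mulrDl mulrDr cs// ct.
- rewrite fZ; split=> [|y Uy]; first exact: utensorZ.
  by rewrite -scalerAl -scalerAr ct.
rewrite tensor_of_center_atens; split=> [|y _].
  apply: (@utensor_atens _ _ _ (fun i => unitary_of_center (u i))).
  by apply: sub_finite_set xu => i /= xu E; apply: xu; rewrite E.
elim/atens_ind: y => [|s t E1 E2|c t E|y].
- by rewrite mul0r mulr0.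
- by rewrite mulrDl mulrDr E1 E2.
- by rewrite -scalerAl -scalerAr E.
rewrite !atensM; congr atens; apply: functional_extensionality_dep => i.
exact/centralP/(valP (x i)).
Qed.

End Tensors.

Theorem theorem3p6 (R : realType) (I : Type) (A : I -> starAlgType R[i])
    (F0 : set I) :
  infinite_set [set: I] ->
  finite_set F0 -> F0 !=set0 ->
  (forall i, ~ F0 i -> lspan (unitary_set (A i)) = [set: A i]) ->
  [/\ (* (a) *)
      group_center (Omega A) = range (Omega_of_center A) /\
      (group_center (Omega A) = [set: Omega A] <->
       finite_set [set i | ~ (forall x y : A i, x * y = y * x)]),
      (* (b) *)
      (forall w : Omega A, ~ group_center (Omega A) w ->
         infinite_set [set (w ^ g)%g | g in [set: Omega A]])
    & (* (c) *)
      ring_center (utensor A) =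
      tensor_of_center A @` utensor (fun i => center_alg (A i))].
Proof.
move=> _ fF0 _ AU; have ZO := group_center_range fF0 AU.
split; last exact: utensor_center ZO.
  by split=> //; apply: group_center_full fF0 AU.
exact: infinite_conjugacy_class.
Qed.
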